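(* Let $v\ge4$. As formal power series in $y$, \[1+\sum_{d=1}^\infty \sum_{D \in \mathcal{D}_{v,d}(132,213)} x^{des(\pi_D)}y^d = \frac{1-yx}{1-y(1+x)}.\]
   Context: A diamond with $v$ vertices ($v\ge4$) is the poset with a least element, a greatest element, and $v-2$ pairwise incomparable middle elements (in a fixed left-to-right order) strictly between them. $\mathcal{D}_{v,d}$ is the set of labellings of $d$ diamonds (placed left to right) by $1,\dots,vd$, each label used once, such that in each diamond least label $<$ each middle label $<$ greatest label. For $D\in\mathcal{D}_{v,d}$, $\pi_D$ is the permutation obtained by reading the diamonds left to right and, within each diamond, the least element, then the middle elements left to right, then the greatest element. $\mathcal{D}_{v,d}(P)$ is the set of $D$ with $\pi_D$ avoiding every classical pattern in $P$. $des(\pi)$ is the number of $i$ with $\pi_i>\pi_{i+1}$. *)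

(* Defs.v *)
From HB Require Import structures.
From mathcomp Require Import all_boot all_order all_algebra.
From mathcomp Require Import boolp.

Set Implicit Arguments.
Unset Strict Implicit.
Unset Printing Implicit Defensive.

Import GRing.Theory.
Local Open Scope ring_scope.

Record fps (R : Type) := Fps { fcoef : nat -> R }.

HB.instance Definition _ (R : Type) := gen_eqMixin (fps R).
HB.instance Definition _ (R : Type) := gen_choiceMixin (fps R).

Lemma fpsP (R : Type) (a b : fps R) : (forall n, fcoef a n = fcoef b n) <-> a = b.
Proof.
split=> [|-> //]; case: a b => [a] [b] /= ab.
by congr Fps; apply: funext.
Qed.

Section FpsRing.
Variable R : comUnitRingType.
Implicit Types a b c : fps R.

Definition fps_zero : fps R := Fps (fun=> 0).
Definition fps_opp a : fps R := Fps (fun n => - fcoef a n).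
Definition fps_add a b : fps R := Fps (fun n => fcoef a n + fcoef b n).

Fact fps_addA : associative fps_add.
Proof. by move=> a b c; apply/fpsP => n /=; rewrite addrA. Qed.
Fact fps_addC : commutative fps_add.
Proof. by move=> a b; apply/fpsP => n /=; rewrite addrC. Qed.
Fact fps_add0 : left_id fps_zero fps_add.
Proof. by move=> a; apply/fpsP => n /=; rewrite add0r. Qed.
Fact fps_addN : left_inverse fps_zero fps_opp fps_add.
Proof. by move=> a; apply/fpsP => n /=; rewrite addNr. Qed.

HB.instance Definition _ :=
  GRing.isZmodule.Build (fps R) fps_addA fps_addC fps_add0 fps_addN.

Definition fpsC (r : R) : fps R := Fps (fun n => if n == 0%N then r else 0).
Definition fpsX : fps R := Fps (fun n => (n == 1%N)%:R).
Definition fps_mul a b : fps R :=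
  Fps (fun n => \sum_(i < n.+1) fcoef a i * fcoef b (n - i)%N).

Definition fps_trunc n a : {poly R} := \poly_(i < n) fcoef a i.

Fact fcoef_mul_trunc n m a b : (n < m)%N ->
  fcoef (fps_mul a b) n = (fps_trunc m a * fps_trunc m b)`_n.
Proof.
move=> nm; rewrite coefM; apply: eq_bigr => i _.
have im : (i < m)%N := leq_trans (ltn_ord i) nm.
by rewrite !coef_poly im (leq_ltn_trans (leq_subr i n) nm).
Qed.

Fact fps_mulC : commutative fps_mul.
Proof.
by move=> a b; apply/fpsP => n; rewrite !(@fcoef_mul_trunc _ n.+1)// mulrC.
Qed.

Fact fps_mulA : associative fps_mul.
Proof.
move=> a b c; apply/fpsP => n.
transitivity ((fps_trunc n.+1 a * (fps_trunc n.+1 b * fps_trunc n.+1 c))`_n).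
  rewrite coefM; apply: eq_bigr => i _.
  rewrite (@fcoef_mul_trunc _ n.+1) ?ltnS ?leq_subr //.
  by rewrite coef_poly ltn_ord.
rewrite mulrA coefM; apply: eq_bigr => i _.
rewrite (@fcoef_mul_trunc _ n.+1) //.
by rewrite [in LHS]coef_poly ltnS leq_subr.
Qed.

Fact fps_mul1 : left_id (fpsC 1) fps_mul.
Proof.
move=> a; apply/fpsP => n /=; rewrite big_ord_recl /= mul1r subn0.
by rewrite big1 ?addr0 // => i _; rewrite mul0r.
Qed.

Fact fps_mulD : left_distributive fps_mul fps_add.
Proof.
move=> a b c; apply/fpsP => n /=; rewrite -big_split; apply: eq_bigr => i _.
by rewrite mulrDl.
Qed.

Fact fps_one_neq0 : fpsC 1 != 0.
Proof. by apply/eqP => /fpsP /(_ 0%N) /= /eqP; rewrite oner_eq0. Qed.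

HB.instance Definition _ :=
  GRing.Zmodule_isComNzRing.Build (fps R)
    fps_mulA fps_mulC fps_mul1 fps_mulD fps_one_neq0.

(* The first n coefficients of a^-1, obtained by solving a * a^-1 = 1 degree  *)
(* by degree.                                                                 *)
Fixpoint fps_inv_seq a n : seq R :=
  if n is m.+1 then
    let s := fps_inv_seq a m in
    rcons s ((fcoef a 0)^-1 *
             ((m == 0%N)%:R - \sum_(k < m) fcoef a (m - k)%N * s`_k))
  else [::].

Definition fps_unit : pred (fps R) := fun a => fcoef a 0 \is a GRing.unit.

(* As for any unitRingType, the inverse of a non-unit is itself.              *)
Definition fps_inv a : fps R :=
  if fps_unit a then Fps (fun n => (fps_inv_seq a n.+1)`_n) else a.

Fact size_fps_inv_seq a n : size (fps_inv_seq a n) = n.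
Proof. by elim: n => //= n IHn; rewrite size_rcons IHn. Qed.

Fact nth_fps_inv_seq a n k : (k < n)%N ->
  (fps_inv_seq a n)`_k = (fps_inv_seq a k.+1)`_k.
Proof.
elim: n => // n IHn; rewrite ltnS leq_eqVlt => /predU1P[-> // | kn].
by rewrite -IHn //= nth_rcons size_fps_inv_seq kn.
Qed.

Fact fps_mulV : {in fps_unit, left_inverse 1 fps_inv *%R}.
Proof.
move=> a Ua; rewrite mulrC; apply/fpsP => n.
rewrite /fps_inv (Ua : fps_unit a); set b := Fps _.
have -> : fcoef (a * b) n = \sum_(k < n.+1) fcoef a (n - k)%N * fcoef b k.
  rewrite mulrC /=; apply: eq_bigr => i _; exact: mulrC.
rewrite big_ord_recr /= subnn nth_rcons size_fps_inv_seq ltnn eqxx.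
rewrite mulrA mulrV // mul1r.
under [X in X + _]eq_bigr => k _ do
  rewrite -/(fps_inv_seq a k.+1) -(nth_fps_inv_seq a (ltn_ord k)).
by rewrite addrC subrK; case: n.
Qed.

Fact fps_unitPl a b : b * a = 1 -> fps_unit a.
Proof.
move=> /fpsP /(_ 0%N) /=; rewrite big_ord1 /= => ba.
by apply/unitrP; exists (fcoef b 0); split=> //; rewrite mulrC.
Qed.

Fact fps_inv_out : {in [predC fps_unit], fps_inv =1 id}.
Proof. by move=> a; rewrite inE /fps_inv => /negbTE Ua; rewrite [fps_unit a]Ua. Qed.

HB.instance Definition _ :=
  GRing.ComNzRing_hasMulInverse.Build (fps R) fps_mulV fps_unitPl fps_inv_out.

End FpsRing.

Local Open Scope nat_scope.

Definition order_iso (s t : seq nat) : bool :=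
  (size s == size t) &&
  [forall i : 'I_(size s), forall j : 'I_(size s),
     (nth 0 s i < nth 0 s j) == (nth 0 t i < nth 0 t j)].

Definition contains (w p : seq nat) : bool :=
  [exists m : (size w).-tuple bool, order_iso (mask m w) p].

Definition avoids (w : seq nat) (P : seq (seq nat)) : bool :=
  all (fun p => ~~ contains w p) P.

Definition des (w : seq nat) : nat :=
  #|[set i : 'I_(size w).-1 | nth 0 w i.+1 < nth 0 w i]|.

(* The strict order of the diamond on 'I_v: 0 is the least element, v.-1 the  *)
(* greatest one, and 1, ..., v - 2 are the middle elements from left to right.*)
Definition diamond_lt (v : nat) : rel 'I_v :=
  fun i j => (i != j) && ((val i == 0) || (val j == v.-1)).

(* D (k, i) is the label of the element i of the k-th diamond from the left;  *)
(* l : 'I_(v * d) stands for the label l.+1. An injective D uses every label  *)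
(* exactly once, since its domain also has v * d elements.                    *)
Definition diamonds (v d : nat) : {set {ffun 'I_d * 'I_v -> 'I_(v * d)}} :=
  [set D : {ffun 'I_d * 'I_v -> 'I_(v * d)} | injectiveb D &&
    [forall k : 'I_d, forall i : 'I_v, forall j : 'I_v,
       diamond_lt i j ==> (D (k, i) < D (k, j))]].

Definition diamond_word (v d : nat) (D : {ffun 'I_d * 'I_v -> 'I_(v * d)}) :
    seq nat :=
  [seq (val (D (k, i))).+1 | k <- enum 'I_d, i <- enum 'I_v].

Definition diamonds_avoiding (v d : nat) (P : seq (seq nat)) :
    {set {ffun 'I_d * 'I_v -> 'I_(v * d)}} :=
  [set D in diamonds v d | avoids (diamond_word D) P].

(* Main.v *)
(** A permutation avoids 132 and 213 iff it is a decreasing sequence of blocks,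
    each block increasing; such a permutation is determined by its descent set,
    since an earlier entry is smaller than a later one iff no descent separates
    them, and every set of positions is the descent set of one. In a diamond the
    first label is the least and the last one the greatest, hence no descent
    separates them: the diamond condition says exactly that descents occur only
    between consecutive diamonds. So d > 0 diamonds contribute
    (1 + x)^(d - 1). *)

Require Import Defs.
From HB Require Import structures.
From mathcomp Require Import all_boot all_order all_algebra.
From mathcomp Require Import zify.

Import GRing.Theory.
Local Open Scope ring_scope.

Section Sequences.
Set Implicit Arguments.
Unset Strict Implicit.
Local Open Scope nat_scope.

Lemma nth_allpairs (S T R : Type) (f : S -> T -> R) (x0 : S) (y0 : T) (z0 : R)
    (s : seq S) (t : seq T) (i j : nat) :
  i < size s -> j < size t ->
  nth z0 [seq f x y | x <- s, y <- t] (i * size t + j) =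
  f (nth x0 s i) (nth y0 t j).
Proof.
move=> + jt; elim: s i => [|x s IHs] [|i] //= si; rewrite nth_cat size_map.
  by rewrite mul0n add0n jt (nth_map y0).
rewrite mulSn -addnA ltnNge leq_addr /= addKn; exact: IHs.
Qed.

Lemma index_iota_cat (i j k : nat) :
  i <= j -> j <= k -> index_iota i k = index_iota i j ++ index_iota j k.
Proof.
by move=> ij jk; rewrite /index_iota -{2}(subnKC ij) -iotaD; congr iota; lia.
Qed.

Lemma subseq_iota (n : nat) (s : seq nat) :
  subseq s (iota 0 n) = sorted ltn s && all (gtn n) s.
Proof.
apply/idP/andP => [sub | [s_sorted s_lt]].
  split; first exact: subseq_sorted ltn_trans _ _ sub (iota_ltn_sorted 0 n).
  by apply/allP => i /(mem_subseq sub); rewrite mem_iota.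
have -> : s = filter (mem s) (iota 0 n).
  apply: (irr_sorted_eq ltn_trans ltnn) => //.
    exact/(sorted_filter ltn_trans)/iota_ltn_sorted.
  move=> i; rewrite mem_filter mem_iota /=.
  by apply/idP/andP => [si | []] //; rewrite si; have /= -> := allP s_lt _ si.
exact: filter_subseq.
Qed.

Lemma subseq_nthP (T : eqType) (x0 : T) (s w : seq T) :
  reflect (exists2 I, subseq I (iota 0 (size w))
                    & s = [seq nth x0 w i | i <- I])
          (subseq s w).
Proof.
have wE : w = [seq nth x0 w i | i <- iota 0 (size w)].
  by rewrite map_nth_iota0 ?take_size.
apply: (iffP idP) => [/subseqP[b _ ->] | [I subI ->]]; last first.
  by rewrite [X in subseq _ X]wE map_subseq.
exists (mask b (iota 0 (size w))); first exact: mask_subseq.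
by rewrite map_mask -wE.
Qed.

End Sequences.

Section Patterns.
Set Implicit Arguments.
Unset Strict Implicit.
Local Open Scope nat_scope.

Lemma containsP (w p : seq nat) :
  reflect (exists2 s, subseq s w & order_iso s p) (contains w p).
Proof.
apply: (iffP existsP) => [[b iso] | [s /subseqP[b /eqP sz_b ->] iso]].
  by exists (mask b w) => //; apply: mask_subseq.
by exists (Tuple sz_b).
Qed.

Lemma contains3P (w : seq nat) (a b c : nat) :
  reflect (exists i j k, [/\ i < j, j < k, k < size w &
             order_iso [:: nth 0 w i; nth 0 w j; nth 0 w k] [:: a; b; c]])
          (contains w [:: a; b; c]).
Proof.
apply: (iffP (containsP _ _)) => [[s /(subseq_nthP 0)[I subI ->] iso] |].
  have /andP[/eqP + _] := iso; rewrite size_map.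
  case: I subI iso => [|i [|j [|k []]]] //.
  rewrite subseq_iota /= => /andP[/and3P[ij jk _] /and4P[_ _ kw _]].
  by exists i, j, k.
move=> [i [j [k [ij jk kw iso]]]].
exists [:: nth 0 w i; nth 0 w j; nth 0 w k] => //.
apply/(subseq_nthP 0); exists [:: i; j; k] => //.
by rewrite subseq_iota /=; lia.
Qed.

Lemma order_iso3 (a b c a' b' c' : nat) :
  order_iso [:: a; b; c] [:: a'; b'; c'] =
  [&& (a < b) == (a' < b'), (a < c) == (a' < c'), (b < a) == (b' < a'),
      (b < c) == (b' < c'), (c < a) == (c' < a') & (c < b) == (c' < b')].
Proof.
rewrite /order_iso eqxx /=; apply/'forall_forallP/idP => [iso | + i j].
  have iso_at i j (i3 : i < 3) (j3 : j < 3) := iso (Ordinal i3) (Ordinal j3).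
  move: (iso_at 0 1 isT isT) (iso_at 0 2 isT isT) (iso_at 1 0 isT isT)
    (iso_at 1 2 isT isT) (iso_at 2 0 isT isT) (iso_at 2 1 isT isT).
  by rewrite /= => -> -> -> -> -> ->.
move: i j => [] [|[|[|i]]] // ? [] [|[|[|j]]] // ? /and5P[? ? ? ? /andP[]] /=;
  by rewrite ?ltnn.
Qed.

Definition reverse_layered (n : nat) (f : nat -> nat) : Prop :=
  forall i j k, i < j -> j < k -> k < n ->
  ~~ (f i < f k < f j) && ~~ (f j < f i < f k).

Lemma avoids_132_213P (w : seq nat) :
  reflect (reverse_layered (size w) (nth 0 w))
          (avoids w [:: [:: 1; 3; 2]; [:: 2; 1; 3]]).
Proof.
rewrite /avoids /= andbT.
apply: (iffP andP) => [[no132 no213] i j k ij jk kw | rl].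
  apply/andP; split;
    [apply: contra no132 | apply: contra no213] => /andP[lt1 lt2].
    by apply/contains3P; exists i, j, k; split; rewrite // order_iso3; lia.
  by apply/contains3P; exists i, j, k; split; rewrite // order_iso3; lia.
by split; apply/contains3P => -[i [j [k [ij jk kw]]]]; rewrite order_iso3;
  have := rl _ _ _ ij jk kw; lia.
Qed.

End Patterns.

Section Descents.
Set Implicit Arguments.
Unset Strict Implicit.
Local Open Scope nat_scope.
Variable n : nat.
Implicit Types (f g : nat -> nat) (P : pred nat) (i j k : nat).

Definition descent f : pred nat := fun k => f k.+1 < f k.

Definition same_order f g : Prop :=
  forall i j, i < n -> j < n -> (f i < f j) = (g i < g j).

Lemma des_count (w : seq nat) :
  des w = count (descent (nth 0 w)) (iota 0 (size w).-1).
Proof.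
rewrite /des cardsE cardE /enum_mem size_filter -enumT.
by rewrite -val_enum_ord count_map.
Qed.

Lemma descent_free_ltn f i j :
  {in gtn n &, injective f} -> i < j -> j < n ->
  ~~ has (descent f) (index_iota i j) -> f i < f j.
Proof.
move=> f_inj ij jn /hasPn no_des.
apply: (homo_ltn_in (D := [pred k | i <= k <= j]) (r := fun a b => a < b));
  rewrite ?inE ?leqnn ?(ltnW ij) //.
- by move=> y x z; apply: ltn_trans.
- by move=> p q + + k; rewrite !inE; lia.
- move=> k; rewrite !inE => ? ?; have := no_des k; have := f_inj k k.+1.
  by rewrite mem_index_iota !inE /descent; lia.
Qed.

Lemma reverse_layered_between f i j k :
  {in gtn n &, injective f} -> reverse_layered n f ->
  i < j -> j < k -> k < n -> f i < f k -> f i < f j < f k.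
Proof.
move=> f_inj rl ij jk kn fik; have := rl i j k ij jk kn.
have := f_inj i j; have := f_inj j k; rewrite !inE; lia.
Qed.

Lemma reverse_layered_ltn f i j :
  {in gtn n &, injective f} -> reverse_layered n f -> i < j -> j < n ->
  (f i < f j) = ~~ has (descent f) (index_iota i j).
Proof.
move=> f_inj rl ij jn; apply/idP/idP; last exact: descent_free_ltn.
move=> fij; apply/hasPn => k; rewrite mem_index_iota -leqNgt => /andP[ik kj].
have fkj : f k < f j.
  move: ik; rewrite leq_eqVlt => /predU1P[<- // | ik].
  by case/andP: (reverse_layered_between f_inj rl ik kj jn fij).
move: kj; rewrite leq_eqVlt => /predU1P[-> | kj]; first exact: ltnW.
by case/andP: (reverse_layered_between f_inj rl (ltnSn k) kj jn fkj) => /ltnW.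
Qed.

Lemma ltn_reverse_layered P f :
  (forall i j, i < j -> j < n -> (f i < f j) = ~~ has P (index_iota i j)) ->
  reverse_layered n f.
Proof.
move=> f_lt i j k ij jk kn.
have ik_split : (f i < f k) = (f i < f j) && (f j < f k).
  rewrite !f_lt //; try lia.
  by rewrite (index_iota_cat (ltnW ij) (ltnW jk)) has_cat negb_or.
by move: ik_split; lia.
Qed.

Lemma eq_descent_same_order f g :
  {in gtn n &, injective f} -> {in gtn n &, injective g} ->
  reverse_layered n f -> reverse_layered n g ->
  (forall k, k.+1 < n -> descent f k = descent g k) -> same_order f g.
Proof.
move=> f_inj g_inj f_rl g_rl eq_des.
have eq_ltn i j : i < j -> j < n -> (f i < f j) = (g i < g j).
  move=> ij jn; rewrite !reverse_layered_ltn //; congr (~~ _).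
  by apply: eq_in_has => k; rewrite mem_index_iota => kij; apply: eq_des; lia.
move=> i j i_n j_n.
have [/eq_ltn -> // | ji | ->] := ltngtP i j; last by rewrite !ltnn.
have := eq_ltn _ _ ji i_n.
by have := f_inj i j i_n j_n; have := g_inj i j i_n j_n; lia.
Qed.

Lemma same_order_reverse_layered f g :
  same_order f g -> reverse_layered n g -> reverse_layered n f.
Proof. by move=> fg rl i j k ij jk kn; rewrite !fg ?rl //; lia. Qed.

(* The summand [n * _] puts each block above all later ones. *)
Definition reverse_layering P k : nat := k + n * count P (index_iota k n).

Lemma reverse_layering_diff P i j : i <= j -> j <= n ->
  reverse_layering P i + j =
  reverse_layering P j + i + n * count P (index_iota i j).
Proof.
move=> ij jn; rewrite /reverse_layering (index_iota_cat ij jn) count_cat mulnDr.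
lia.
Qed.

Lemma reverse_layering_ltn P i j : i < j -> j < n ->
  (reverse_layering P i < reverse_layering P j) = ~~ has P (index_iota i j).
Proof.
move=> ij jn; have := reverse_layering_diff P (ltnW ij) (ltnW jn).
rewrite has_count -leqNgt leqn0.
by case: (count P _) => [|c]; rewrite ?mulnS /=; lia.
Qed.

Lemma reverse_layering_inj P : {in gtn n &, injective (reverse_layering P)}.
Proof.
move=> i j; rewrite !inE.
wlog ij : i j / i < j => [inj_lt i_n j_n | i_n j_n].
  by have [ij /inj_lt | ji /esym/inj_lt/esym | ] := ltngtP i j; auto.
have := reverse_layering_diff P (ltnW ij) (ltnW j_n).
by case: (count P _) => [|c]; rewrite ?mulnS; lia.
Qed.

Lemma reverse_layering_descent P k : k.+1 < n ->
  descent (reverse_layering P) k = P k.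
Proof.
move=> k1n; have := reverse_layering_ltn P (ltnSn k) k1n.
have := @reverse_layering_inj P k k.+1; rewrite /index_iota subSnn /= orbF !inE.
by rewrite /descent; case: (P k) => /=; lia.
Qed.

Lemma reverse_layering_reverse_layered P :
  reverse_layered n (reverse_layering P).
Proof. exact: ltn_reverse_layered (@reverse_layering_ltn P). Qed.

End Descents.

Section Ranks.
Set Implicit Arguments.
Unset Strict Implicit.
Local Open Scope nat_scope.
Variable T : finType.
Implicit Types (key : T -> nat) (t u : T).

Definition rank key t : nat := #|[set u | key u < key t]|.

Lemma rank_lt_card key t : rank key t < #|T|.
Proof.
rewrite -cardsT; apply/proper_card/properP; split; first exact: subsetT.
by exists t; rewrite ?inE ?ltnn.
Qed.

Lemma ltn_rank key t u : (rank key t < rank key u) = (key t < key u).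
Proof.
have [tu | ut] := ltnP (key t) (key u); last first.
  apply/negbTE; rewrite -leqNgt; apply/subset_leq_card/subsetP => z.
  by rewrite !inE => /leq_trans ->.
apply/proper_card/properP; split; last by exists t; rewrite !inE ?ltnn.
by apply/subsetP => z; rewrite !inE => /ltn_trans ->.
Qed.

Lemma card_ord_ltn (n i : nat) : i <= n -> #|[set x : 'I_n | x < i]| = i.
Proof.
move=> i_n; rewrite cardsE -sum1_card -(big_ord_widen n (fun=> 1)) //.
by rewrite sum1_card card_ord.
Qed.

Lemma rank_ord (n : nat) (D : T -> 'I_n) t :
  #|T| = n -> injective D -> rank D t = D t.
Proof.
move=> cardT D_inj; rewrite -[RHS](@card_ord_ltn n) 1?ltnW //.
rewrite /rank -(card_imset _ D_inj); congr #|pred_of_set _|.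
have le_cards : #|'I_n| <= #|T| by rewrite card_ord cardT.
have [g _ Kg] := inj_card_bij D_inj le_cards.
apply/setP => x; rewrite inE; apply/imsetP/idP => [[u] | xt].
  by rewrite inE => + ->.
by exists (g x); rewrite ?inE Kg.
Qed.

Lemma eq_rank key1 key2 :
  (forall t u, (key1 t < key1 u) = (key2 t < key2 u)) -> rank key1 =1 rank key2.
Proof. by move=> eq_key t; apply: eq_card => u; rewrite !inE eq_key. Qed.

Definition ranking (n : nat) (cardT : #|T| = n) key : {ffun T -> 'I_n} :=
  [ffun t => cast_ord cardT (Ordinal (rank_lt_card key t))].

Lemma ltn_ranking (n : nat) (cardT : #|T| = n) key t u :
  (ranking cardT key t < ranking cardT key u) = (key t < key u).
Proof. by rewrite !ffunE /= ltn_rank. Qed.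

Lemma ranking_inj (n : nat) (cardT : #|T| = n) key :
  injective key -> injective (ranking cardT key).
Proof.
move=> key_inj t u eq_tu; apply: key_inj.
have := ltn_ranking cardT key t u; have := ltn_ranking cardT key u t.
by rewrite eq_tu ltnn; lia.
Qed.

End Ranks.

Section Diamonds.
Set Implicit Arguments.
Unset Strict Implicit.
Local Open Scope nat_scope.
Variables m d : nat.
Local Notation v := m.+2.
Implicit Types (D : {ffun 'I_d * 'I_v -> 'I_(v * d)}) (B : {set 'I_d.-1}).
Implicit Types (t : 'I_d * 'I_v) (p : nat).

Local Notation avoiding :=
  (diamonds_avoiding v d [:: [:: 1; 3; 2]; [:: 2; 1; 3]]).
Local Notation label D := (nth 0 (diamond_word D)).

Definition pos t : nat := t.1 * v + t.2.

Lemma pos_lt t : pos t < d * v.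
Proof.
case: t => k i; rewrite /pos /=.
by have := ltn_ord i; have := leq_mul (ltn_ord k) (leqnn v); rewrite mulSn; lia.
Qed.

Lemma pos_surj p : p < d * v -> exists t, p = pos t.
Proof.
move=> p_lt; have k_lt : p %/ v < d by rewrite ltn_divLR.
exists (Ordinal k_lt, Ordinal (ltn_pmod p (isT : 0 < v))).
by rewrite /pos /= -divn_eq.
Qed.

Lemma pos_inj : injective pos.
Proof.
move=> [k i] [l j]; rewrite /pos /= => eq_pos.
have := congr1 (divn^~ v) eq_pos; have := congr1 (modn^~ v) eq_pos.
rewrite !modnMDl !modn_small // !divnMDl // !divn_small // !addn0.
by move=> /ord_inj -> /ord_inj ->.
Qed.

Lemma size_diamond_word D : size (diamond_word D) = d * v.
Proof. by rewrite size_allpairs !size_enum_ord. Qed.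

Lemma label_pos D t : label D (pos t) = (D t).+1.
Proof.
case: t => k i; have := @nth_allpairs _ _ _ (fun k i => (val (D (k, i))).+1)
  k i 0 (enum 'I_d) (enum 'I_v) k i.
by rewrite !size_enum_ord !nth_ord_enum; apply.
Qed.

Lemma label_inj D : injective D -> {in gtn (d * v) &, injective (label D)}.
Proof.
move=> D_inj p q; rewrite !inE => /pos_surj[t ->] /pos_surj[u ->].
by rewrite !label_pos => -[/ord_inj/D_inj ->].
Qed.

Lemma dvdn_posS (k : 'I_d) (i : 'I_v) : (v %| (pos (k, i)).+1) = (i == ord_max).
Proof.
rewrite /pos -addnS dvdn_addr ?dvdn_mull // -val_eqE /=.
apply/idP/eqP => [/dvdn_leq | -> //].
by have := ltn_ord i; lia.
Qed.

Definition diamond_monotone D : Prop :=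
  forall k i j, diamond_lt i j -> D (k, i) < D (k, j).

Lemma diamondsP D :
  reflect (injective D /\ diamond_monotone D) (D \in diamonds v d).
Proof.
rewrite inE; apply: (iffP andP) => -[/injectiveP D_inj D_lt]; split=> //.
  move=> k i j.
  by move: D_lt => /forallP/(_ k)/forallP/(_ i)/forallP/(_ j)/implyP.
by apply/'forall_forallP => k i; apply/forallP => j; apply/implyP; apply: D_lt.
Qed.

(* No descent can occur inside a diamond once its first label is smaller than
   its last one. *)
Lemma diamond_monotone_descents D :
  injective D -> reverse_layered (d * v) (label D) ->
  diamond_monotone D <->
  (forall p, p.+1 < d * v -> descent (label D) p -> v %| p.+1).
Proof.
move=> D_inj D_rl; have D_ltn k (i j : 'I_v) : i < j ->
    (D (k, i) < D (k, j)) =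
    ~~ has (descent (label D)) (index_iota (pos (k, i)) (pos (k, j))).
  move=> ij; rewrite -ltnS -!label_pos.
  rewrite (reverse_layered_ltn (label_inj D_inj)) ?pos_lt //.
  by rewrite ltn_add2l.
split=> [D_mono p p1_lt | D_des k i j].
  have [[k i] ->] := pos_surj (ltnW p1_lt); rewrite dvdn_posS.
  apply: contraTT => i_neq_max.
  have : D (k, ord0) < D (k, ord_max) by apply: D_mono.
  rewrite D_ltn // => /hasPn; apply.
  rewrite mem_index_iota leq_add2l ltn_add2l /=.
  by move: (ltn_ord i) i_neq_max; rewrite -val_eqE /=; lia.
rewrite /diamond_lt -val_eqE /= => i_lt_j; have ij : i < j.
  by move: i_lt_j (ltn_ord i) (ltn_ord j); lia.
rewrite D_ltn //; apply/hasPn => p; rewrite mem_index_iota => /andP[ip pj].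
have r_lt_j : p - k * v < j by move: ip pj; rewrite /pos /=; lia.
have pE : p = pos (k, Ordinal (ltn_trans r_lt_j (ltn_ord j))).
  by move: ip; rewrite /pos /=; lia.
have p1_lt : p.+1 < d * v := leq_ltn_trans pj (pos_lt _).
apply/negP => /(D_des _ p1_lt); rewrite pE dvdn_posS -val_eqE /=.
have := ltn_ord j; lia.
Qed.

Lemma diamonds_avoidingP D :
  reflect [/\ injective D, reverse_layered (d * v) (label D)
             & forall p, p.+1 < d * v -> descent (label D) p -> v %| p.+1]
          (D \in avoiding).
Proof.
rewrite inE; apply: (iffP andP).
  case=> /diamondsP[D_inj D_mono] /avoids_132_213P.
  rewrite size_diamond_word => D_rl.
  by split=> //; apply/diamond_monotone_descents.
case=> D_inj D_rl /(diamond_monotone_descents D_inj D_rl) D_mono.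
by split; [apply/diamondsP | apply/avoids_132_213P; rewrite size_diamond_word].
Qed.

Definition border (k : 'I_d.-1) : nat := (k.+1 * v).-1.

Lemma borderS k : (border k).+1 = k.+1 * v.
Proof. by []. Qed.

Lemma border_lt k : (border k).+1 < d * v.
Proof. by rewrite borderS ltn_pmul2r //; have := ltn_ord k; lia. Qed.

Lemma borderP p : p.+1 < d * v -> reflect (exists k, p = border k) (v %| p.+1).
Proof.
move=> p1_lt; apply: (iffP idP) => [/dvdnP[[|k] pE] | [k ->]]; first by [].
  have k_lt : k < d.-1.
    by move: p1_lt; rewrite pE ltn_pmul2r //; case: (d).
  by exists (Ordinal k_lt); apply: (congr1 predn pE).
by rewrite borderS dvdn_mull.
Qed.

Lemma border_inj : injective border.
Proof.
move=> k l /(congr1 S)/eqP; rewrite !borderS eqn_pmul2r // => /eqP[].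
exact: val_inj.
Qed.

Definition border_descents D : {set 'I_d.-1} :=
  [set k | descent (label D) (border k)].

Lemma descent_border D p : D \in avoiding -> p.+1 < d * v ->
  descent (label D) p = (p \in [seq border k | k in border_descents D]).
Proof.
case/diamonds_avoidingP => _ _ D_des p1_lt.
apply/idP/imageP => [p_des | [k + ->]].
  have /(borderP p1_lt)[k pE] := D_des p p1_lt p_des.
  by exists k; rewrite // inE -pE.
by rewrite inE.
Qed.

Lemma des_diamond_word D : D \in avoiding ->
  des (diamond_word D) = #|border_descents D|.
Proof.
move=> D_in; rewrite des_count size_diamond_word -size_filter.
rewrite -(size_image border).
apply/perm_size/uniq_perm.
- exact/filter_uniq/iota_uniq.
- by rewrite map_inj_uniq ?enum_uniq //; apply: border_inj.
move=> p; rewrite mem_filter mem_iota /=.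
have [p_lt | p_ge] := ltnP p (d * v).-1.
  by rewrite andbT descent_border //; lia.
rewrite andbF; apply/esym/imageP => -[k _ pE].
by have := border_lt k; rewrite -pE; lia.
Qed.

Lemma card_labels : #|{: 'I_d * 'I_v}| = v * d.
Proof. by rewrite card_prod !card_ord mulnC. Qed.

Lemma border_descents_inj : {in avoiding &, injective border_descents}.
Proof.
move=> D E D_in E_in eq_border.
have [[D_inj D_rl _] [E_inj E_rl _]] :=
  (diamonds_avoidingP _ D_in, diamonds_avoidingP _ E_in).
have eq_order : same_order (d * v) (label D) (label E).
  apply: eq_descent_same_order => //; try exact: label_inj.
  by move=> p p1_lt; rewrite !descent_border // eq_border.
apply/ffunP => t; apply: ord_inj.
rewrite -(rank_ord _ card_labels D_inj) -(rank_ord _ card_labels E_inj).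
apply: eq_rank => u w.
by have := eq_order _ _ (pos_lt u) (pos_lt w); rewrite !label_pos !ltnS.
Qed.

Lemma border_descents_surj B :
  exists2 D, D \in avoiding & border_descents D = B.
Proof.
pose f := reverse_layering (d * v) [in [seq border k | k in B]].
have f_inj : {in gtn (d * v) &, injective f} by apply: reverse_layering_inj.
pose D := ranking card_labels (f \o pos).
have D_inj : injective D.
  apply: ranking_inj => t u /f_inj; rewrite !inE !pos_lt => /(_ isT isT).
  exact: pos_inj.
have eq_order : same_order (d * v) (label D) f.
  move=> p q /pos_surj[t ->] /pos_surj[u ->].
  by rewrite !label_pos ltnS ltn_ranking.
have D_des p : p.+1 < d * v ->
    descent (label D) p = (p \in [seq border k | k in B]).
  move=> p1_lt; rewrite /descent eq_order //; last exact: ltnW.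
  exact: reverse_layering_descent.
exists D; last first.
  by apply/setP => k; rewrite inE D_des ?border_lt // (mem_image border_inj).
apply/diamonds_avoidingP; split=> //.
  apply: same_order_reverse_layered eq_order _.
  exact: reverse_layering_reverse_layered.
move=> p p1_lt; rewrite D_des // => /imageP[k _ pE].
by apply/borderP => //; exists k.
Qed.

End Diamonds.

Lemma sum_expr_card (R : comPzSemiRingType) (T : finType) (x : R) :
  \sum_(S : {set T}) x ^+ #|S| = (1 + x) ^+ #|T|.
Proof.
rewrite addrC -prodr_const bigA_distr; apply: eq_bigr => S _.
by rewrite -prodr_const big_mkcond.
Qed.

Lemma sum_expr_des_avoiding (R : comPzSemiRingType) (m d : nat) (x : R) :
  \sum_(D in diamonds_avoiding m.+2 d [:: [:: 1; 3; 2]; [:: 2; 1; 3]]%N)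
     x ^+ des (diamond_word D) = (1 + x) ^+ d.-1.
Proof.
rewrite -[in RHS](card_ord d.-1) -sum_expr_card.
under eq_bigr do rewrite des_diamond_word //.
rewrite -(big_imset (fun S : {set 'I_d.-1} => x ^+ #|S|)
  (@border_descents_inj m d)) /=.
apply: eq_bigl => S.
by have [D D_in <-] := border_descents_surj m S; rewrite imset_f.
Qed.

Section PowerSeries.
Variable R : comUnitRingType.
Implicit Types (a b : fps R) (r s : R) (n : nat).

Lemma fcoefB a b n : fcoef (a - b) n = fcoef a n - fcoef b n.
Proof. by []. Qed.

Lemma fcoef1 n : fcoef (1 : fps R) n = (n == 0)%:R.
Proof. by case: n. Qed.

Lemma fpsCD r s : fpsC (r + s) = fpsC r + fpsC s.
Proof. by apply/fpsP => -[|n] //=; rewrite addr0. Qed.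

Lemma fcoefCM r a n : fcoef (fpsC r * a) n = r * fcoef a n.
Proof.
rewrite /= big_ord_recl /= subn0 big1 ?addr0 // => i _.
by rewrite mul0r.
Qed.

Lemma fcoefXM a n : fcoef (fpsX R * a) n = if n is k.+1 then fcoef a k else 0.
Proof.
case: n => [|n]; first by rewrite /= big_ord1 mul0r.
rewrite /= big_ord_recl mul0r add0r big_ord_recl mul1r subSS subn0.
by rewrite big1 ?addr0 // => i _; rewrite mul0r.
Qed.

Lemma unitr_subXM a : 1 - fpsX R * a \is a GRing.unit.
Proof.
rewrite -[_ \is a _]/(fps_unit _) /fps_unit fcoefB fcoef1 fcoefXM.
by rewrite subr0 unitr1.
Qed.

Lemma fps_geometric r : (1 - fpsX R * fpsC r)^-1 = Fps (fun n => r ^+ n).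
Proof.
apply: mulr1_eq; apply/fpsP => n.
rewrite mulrBl mul1r -mulrA fcoefB fcoefXM fcoef1.
by case: n => [|n]; rewrite ?subr0 // fcoefCM /= exprS subrr.
Qed.

End PowerSeries.

Theorem theorem3p2 (v : nat) (hv : (4 <= v)%N) :
  let x : fps {poly int} := fpsC 'X in
  let y : fps {poly int} := fpsX _ in
  1 + Fps (fun d => if (1 <= d)%N then
             \sum_(D in diamonds_avoiding v d [:: [:: 1; 3; 2]; [:: 2; 1; 3]]%N)
                'X^(des (diamond_word D))
           else 0)
  = (1 - y * x) / (1 - y * (1 + x)).
Proof.
move=> x y; case: v hv => [|[|m]] // _; set u := 1 - y * (1 + x).
have u_geometric : u^-1 = Fps (fun d => (1 + 'X) ^+ d).
  by rewrite -fps_geometric fpsCD.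
have -> : Fps (fun d => if (1 <= d)%N then
    \sum_(D in diamonds_avoiding m.+2 d [:: [:: 1; 3; 2]; [:: 2; 1; 3]]%N)
      'X^(des (diamond_word D)) else 0) = y / u.
  rewrite u_geometric; apply/fpsP => -[|d]; rewrite fcoefXM //=.
  exact: sum_expr_des_avoiding.
rewrite -[X in X + _](divrr (unitr_subXM _ : u \is a GRing.unit)) -mulrDl.
by congr (_ / _); rewrite /u mulrDr mulr1 opprD addrA addrAC subrK.
Qed.
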